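(* Let $\lambda$ be a nonzero real number and $r\ge 0$ an integer. For all integers $m,n\ge 0$, $$\mathrm{LB}_{n+m,\lambda}^{(r)}(t)=\sum_{j=0}^{m}\sum_{k=0}^{n}\binom{n}{k}L_{\lambda}^{r}(m,j)\langle m+j\rangle_{n-k}\,t^{j}\lambda^{n-k}\,\mathrm{LB}_{k,\lambda}^{(r)}(t).$$ In particular, letting $t=1$ yields $$\mathrm{LB}_{n+m,\lambda}^{(r)}=\sum_{j=0}^{m}\sum_{k=0}^{n}\binom{n}{k}L_{\lambda}^{r}(m,j)\langle m+j\rangle_{n-k}\,\lambda^{n-k}\,\mathrm{LB}_{k,\lambda}^{(r)}.$$
   Context: Rising factorials: $\langle x\rangle_0=1$, $\langle x\rangle_n=x(x+1)\cdots(x+n-1)$ for $n\ge 1$. For nonzero real $\lambda$, the degenerate falling and rising factorials are $(x)_{0,\lambda}=1$, $(x)_{n,\lambda}=x(x-\lambda)\cdots(x-(n-1)\lambda)$ and $\langle x\rangle_{0,\lambda}=1$, $\langle x\rangle_{n,\lambda}=x(x+\lambda)\cdots(x+(n-1)\lambda)$ for $n\ge1$. The $\lambda$-analogues of the $r$-Lah numbers, $L_\lambda^r(n,k)$ ($0\le k\le n$), are defined by the polynomial identity $\langle x+r\rangle_{n,\lambda}=\sum_{k=0}^n L_\lambda^r(n,k)(x)_{k,\lambda}$ for $n\ge0$. The $\lambda$-analogue of the $r$-Lah-Bell polynomials is $\mathrm{LB}_{n,\lambda}^{(r)}(x)=\sum_{k=0}^n L_\lambda^r(n,k)x^k$ for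 $n\ge0$, and $\mathrm{LB}_{n,\lambda}^{(r)}=\mathrm{LB}_{n,\lambda}^{(r)}(1)$. *)

(* Defs.v *)
From HB Require Import structures.
From mathcomp Require Import all_boot all_order all_algebra.
From mathcomp Require Import reals.

Set Implicit Arguments.
Unset Strict Implicit.
Unset Printing Implicit Defensive.

Import Order.TTheory GRing.Theory Num.Theory.
Local Open Scope ring_scope.

Section Factorials.
Variable A : comNzRingType.

Definition rising (x : A) (n : nat) : A := \prod_(i < n) (x + i%:R).

Definition deg_falling (lambda x : A) (n : nat) : A :=
  \prod_(i < n) (x - i%:R * lambda).

Definition deg_rising (lambda x : A) (n : nat) : A :=
  \prod_(i < n) (x + i%:R * lambda).

End Factorials.

Section Lah.
Variable R : realType.
Implicit Types (lambda : R) (r n k : nat) (p : {poly R}).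

Lemma deg_fallingX_monic lambda k :
  deg_falling lambda%:P 'X k \is monic /\
  size (deg_falling lambda%:P 'X k) = k.+1.
Proof.
have -> : deg_falling lambda%:P 'X k =
    \prod_(i < k) ('X - (i%:R * lambda)%:P) :> {poly R}.
  by apply: eq_bigr => i _; rewrite polyCM polyC_natr.
split; first exact: monic_prod_XsubC.
by rewrite size_prod_XsubC /index_enum -enumT size_enum_ord.
Qed.

Lemma size_deg_risingX lambda r n :
  (size (deg_rising lambda%:P ('X + r%:R%:P) n) <= n.+1)%N.
Proof.
have -> : deg_rising lambda%:P ('X + r%:R%:P) n =
    \prod_(i < n) ('X - (- (r%:R + i%:R * lambda))%:P) :> {poly R}.
  apply: eq_bigr => i _.
  by rewrite polyCN opprK polyCD polyCM !polyC_natr addrA.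
by rewrite size_prod_XsubC /index_enum -enumT size_enum_ord.
Qed.

Lemma deg_fallingX_span lambda n p : (size p <= n)%N ->
  exists a : {ffun 'I_n -> R},
    p == \sum_(k < n) a k *: deg_falling lambda%:P 'X k.
Proof.
elim: n p => [|n IHn] p le_p.
  exists [ffun=> 0]; rewrite big_ord0.
  by move: le_p; rewrite leqn0 size_poly_eq0.
have [mon sz] := deg_fallingX_monic lambda n.
have le_q : (size (p - (p`_n)%R *: deg_falling lambda%:P 'X n)%R <= n)%N.
  apply/leq_sizeP => j; rewrite leq_eqVlt => /predU1P[<-|lt_nj].
    rewrite coefB coefZ; move: mon; rewrite monicE lead_coefE sz /= => /eqP->.
    by rewrite mulr1 subrr.
  rewrite coefB coefZ [p`_j]nth_default ?(leq_trans le_p) //.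
  by rewrite [X in _ * X]nth_default ?sz // mulr0 subrr.
have [a /eqP Ha] := IHn _ le_q.
exists [ffun k : 'I_n.+1 => if unlift ord_max k is Some i then a i else p`_n].
rewrite big_ord_recr /= ffunE unlift_none -subr_eq Ha; apply/eqP.
apply: eq_bigr => i _; rewrite ffunE.
have -> : widen_ord (leqnSn n) i = lift ord_max i.
  by apply: val_inj; rewrite /= /bump leqNgt ltn_ord.
by rewrite liftK.
Qed.

Lemma deg_fallingX_inj lambda n (a b : {ffun 'I_n -> R}) :
  \sum_(k < n) a k *: deg_falling lambda%:P 'X k =
  \sum_(k < n) b k *: deg_falling lambda%:P 'X k -> a = b.
Proof.
move=> /eqP; rewrite -subr_eq0 -sumrB => /eqP H.
suff free m (c : nat -> R) :
    \sum_(k < m) c k *: deg_falling lambda%:P 'X k = 0 ->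
    forall k, (k < m)%N -> c k = 0.
  apply/ffunP => i; apply/eqP; rewrite -subr_eq0; apply/eqP.
  pose c k := if insub k is Some j then a j - b j else 0.
  have cE (j : 'I_n) : c j = a j - b j by rewrite /c valK.
  rewrite -cE; apply: (free n) => //.
  by rewrite -[RHS]H; apply: eq_bigr => j _; rewrite cE scalerBl.
elim: m => [//|m IHm]; rewrite big_ord_recr /= => Hs.
have cm0 : c m = 0.
  have /(congr1 (fun p : {poly R} => p`_m)) := Hs.
  have [mon sz] := deg_fallingX_monic lambda m.
  rewrite coef0 coefD coefZ; move: mon; rewrite monicE lead_coefE sz => /eqP /= ->.
  rewrite mulr1 coef_sum big1 ?add0r // => i _.
  rewrite coefZ nth_default ?mulr0 //.
  by have [_ ->] := deg_fallingX_monic lambda i.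
move=> k; rewrite ltnS leq_eqVlt => /predU1P[-> //|]; apply: IHm.
by move: Hs; rewrite cm0 scale0r addr0.
Qed.

Lemma lambda_rLah_exists lambda r n :
  exists a : {ffun 'I_n.+1 -> R},
    deg_rising lambda%:P ('X + r%:R%:P) n ==
    \sum_(k < n.+1) a k *: deg_falling lambda%:P 'X k.
Proof. exact/deg_fallingX_span/size_deg_risingX. Qed.

(* The coefficients are selected by their defining polynomial identity; they
   are determined by it, see lambda_rLah_unique. *)
Definition lambda_rLah lambda r n (k : 'I_n.+1) : R :=
  xchoose (lambda_rLah_exists lambda r n) k.
Arguments lambda_rLah lambda r n k : clear implicits.

Lemma lambda_rLahP lambda r n :
  deg_rising lambda%:P ('X + r%:R%:P) n =
  \sum_(k < n.+1) lambda_rLah lambda r n k *: deg_falling lambda%:P 'X k.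
Proof. exact/eqP/(xchooseP (lambda_rLah_exists lambda r n)). Qed.

Lemma lambda_rLah_unique lambda r n (a : 'I_n.+1 -> R) :
  deg_rising lambda%:P ('X + r%:R%:P) n =
    \sum_(k < n.+1) a k *: deg_falling lambda%:P 'X k ->
  forall k : 'I_n.+1, a k = lambda_rLah lambda r n k.
Proof.
move=> Ha k; rewrite /lambda_rLah.
rewrite -[xchoose _](@deg_fallingX_inj lambda _ [ffun k => a k]) ?ffunE //.
rewrite -(eqP (xchooseP (lambda_rLah_exists lambda r n))) Ha.
by apply: eq_bigr => i _; rewrite ffunE.
Qed.

Definition rLahBell_poly lambda r n : {poly R} :=
  \sum_(k < n.+1) lambda_rLah lambda r n k *: 'X^k.

Definition rLahBell lambda r n : R := (rLahBell_poly lambda r n).[1].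

End Lah.

Arguments lambda_rLah {R} lambda r n k.

(* Main.v *)
Require Import Defs.
From HB Require Import structures.
From mathcomp Require Import all_boot all_order all_algebra.
From mathcomp Require Import reals.
From mathcomp Require Import ring.

(** The linear map [umbral] sending [X^k] to the degenerate falling factorial
    (x)_{k,lambda} is injective and sends LB_{n,lambda}^{(r)} to
    <x + r>_{n,lambda}.  It turns multiplication by [X^j] into "shift by
    [- j lambda], then multiply by (x)_{j,lambda}".  The theorem is the preimage
    of the factorisation <x+r>_{n+m} = <x+r>_m <x+r+m lambda>_n: expand the first
    factor in the (x)_j, write the second one as the shift by [- j lambda] of
    <x+r+(m+j) lambda>_n and expand that by the Vandermonde identity. *)

Set Implicit Arguments.
Unset Strict Implicit.
Unset Printing Implicit Defensive.

Import Order.TTheory GRing.Theory Num.Theory.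
Local Open Scope ring_scope.

Section DegenerateFactorials.
Variables (A : comNzRingType) (l : A).

Lemma deg_risingS x n :
  deg_rising l x n.+1 = deg_rising l x n * (x + n%:R * l).
Proof. by rewrite /deg_rising big_ord_recr. Qed.

Lemma deg_risingD x m n :
  deg_rising l x (m + n) = deg_rising l x m * deg_rising l (x + m%:R * l) n.
Proof.
rewrite /deg_rising big_split_ord; congr (_ * _); apply: eq_bigr => i _ /=.
by rewrite natrD mulrDl addrA.
Qed.

Lemma deg_fallingD x j k :
  deg_falling l x (j + k) = deg_falling l x j * deg_falling l (x - j%:R * l) k.
Proof.
rewrite /deg_falling big_split_ord; congr (_ * _); apply: eq_bigr => i _ /=.
by rewrite natrD mulrDl opprD addrA.
Qed.

(** This is where the ordinary rising factorials of the theorem come from: each factor at a multiple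
    of [l] contributes one [l]. *)
Lemma deg_rising_scale x n : deg_rising l (x * l) n = rising x n * l ^+ n.
Proof.
rewrite /deg_rising /rising; under eq_bigr do rewrite -mulrDl.
by rewrite big_split /= prodr_const card_ord.
Qed.

(** Induction on [n]: the new factor [x + y + n l] splits as [(x + k l) + (y + (n - k) l)], so each
    term raises either its first or its second index, and Pascal's rule recombines the two sums. *)
Lemma deg_rising_Vandermonde x y n :
  deg_rising l (x + y) n =
  \sum_(k < n.+1) 'C(n, k)%:R * deg_rising l x k * deg_rising l y (n - k).
Proof.
elim: n => [|n IHn].
  by rewrite big_ord1 /deg_rising !big_ord0 !mulr1.
pose F (i j : nat) := deg_rising l x i * deg_rising l y j.
transitivity (\sum_(k < n.+1) 'C(n, k)%:R * F k.+1 (n - k)%N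
            + \sum_(k < n.+1) 'C(n, k)%:R * F k (n - k).+1).
  rewrite deg_risingS IHn mulr_suml -big_split; apply: eq_bigr => k _ /=.
  have -> : n%:R = k%:R + (n - k)%:R :> A by rewrite -natrD subnKC // -ltnS.
  by rewrite /F !deg_risingS; ring.
(* The terms with [k = 0] match; Pascal's rule applies to the rest, indexed from 1. *)
rewrite [RHS]big_ord_recl [X in _ + X]big_ord_recl /= addrCA !bin0 !subn0.
rewrite /F -mulrA; congr (_ + _).
under [RHS]eq_bigr => k _ do
  rewrite /bump /= add1n binS natrD subSS addrC !mulrDl.
rewrite big_split /=; congr (_ + _).
  by apply: eq_bigr => k _; rewrite mulrA.
(* The surplus top term carries ['C(n, n.+1) = 0]. *)
rewrite [RHS]big_ord_recr /= bin_small // !mul0r addr0.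
apply: eq_bigr => k _.
by rewrite /bump /= add1n mulrA subnSK.
Qed.

End DegenerateFactorials.

Lemma comp_deg_falling (A : comNzRingType) (l : A) (p q : {poly A}) k :
  deg_falling l%:P p k \Po q = deg_falling l%:P (p \Po q) k.
Proof.
rewrite /deg_falling rmorph_prod; apply: eq_bigr => i _ /=.
by rewrite comp_polyB comp_polyM -polyC_natr !comp_polyC.
Qed.

Lemma comp_deg_rising (A : comNzRingType) (l : A) (p q : {poly A}) k :
  deg_rising l%:P p k \Po q = deg_rising l%:P (p \Po q) k.
Proof.
rewrite /deg_rising rmorph_prod; apply: eq_bigr => i _ /=.
by rewrite comp_polyD comp_polyM -polyC_natr !comp_polyC.
Qed.

Section Umbral.
Variables (R : realType) (lambda : R).
Implicit Types (p q : {poly R}) (r m n j k : nat).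

Local Notation fall := (deg_falling lambda%:P 'X).

Definition umbral p : {poly R} := \sum_(k < size p) p`_k *: fall k.

(** Coefficients beyond the size vanish, so polynomials of different sizes can be compared over one
    common range; linearity and injectivity both rely on this. *)
Lemma umbral_widen n p : (size p <= n)%N ->
  umbral p = \sum_(k < n) p`_k *: fall k.
Proof.
move=> le_pn; rewrite /umbral (big_ord_widen n (fun k => p`_k *: fall k)) //.
rewrite big_mkcond; apply: eq_bigr => k _; case: ltnP => // le_pk.
by rewrite nth_default // scale0r.
Qed.

Lemma umbral_is_linear : linear umbral.
Proof.
move=> a p q; pose n := maxn (size p) (size q).
have le_pn : (size p <= n)%N by exact: leq_maxl.
have le_qn : (size q <= n)%N by exact: leq_maxr.
rewrite (umbral_widen le_pn) (umbral_widen le_qn) (@umbral_widen n); last first.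
  rewrite (leq_trans (size_polyD _ _)) // geq_max le_qn andbT.
  exact: leq_trans (size_scale_leq _ _) le_pn.
rewrite scaler_sumr -big_split; apply: eq_bigr => k _ /=.
by rewrite coefD coefZ scalerDl scalerA.
Qed.

HB.instance Definition _ :=
  GRing.isLinear.Build R {poly R} {poly R} *:%R umbral umbral_is_linear.

Lemma umbral_inj : injective umbral.
Proof.
move=> p q eq_pq; pose n := maxn (size p) (size q).
have le_pn : (size p <= n)%N by exact: leq_maxl.
have le_qn : (size q <= n)%N by exact: leq_maxr.
have /ffunP eq_coef : [ffun k : 'I_n => p`_k] = [ffun k : 'I_n => q`_k].
  apply: (@deg_fallingX_inj R lambda).
  under eq_bigr do rewrite ffunE.
  under [RHS]eq_bigr do rewrite ffunE.
  by rewrite -!umbral_widen.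
apply/polyP => i; have [lt_in|le_ni] := ltnP i n.
  by have := eq_coef (Ordinal lt_in); rewrite !ffunE.
by rewrite !nth_default // (leq_trans _ le_ni).
Qed.

Lemma umbralXn k : umbral 'X^k = fall k.
Proof.
rewrite /umbral size_polyXn big_ord_recr /= coefXn eqxx scale1r big1 ?add0r //.
by move=> i _; rewrite coefXn ltn_eqF ?scale0r.
Qed.

(** By linearity it suffices to take [p = 'X^k], where this is the splitting of the falling
    factorial of length [j + k] after its first [j] factors. *)
Lemma umbral_mulXn j p :
  umbral ('X^j * p) = fall j * (umbral p \Po ('X - (j%:R * lambda)%:P)).
Proof.
rewrite -[p]coefK poly_def mulr_sumr.
rewrite ![umbral (\sum_(_ < _) _)]linear_sum linear_sum mulr_sumr /=.
apply: eq_bigr => k _.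
rewrite -scalerAr !linearZ /= -exprD !umbralXn -scalerAr; congr (_ *: _).
by rewrite comp_deg_falling comp_polyX deg_fallingD polyCM polyC_natr.
Qed.

Lemma umbral_rLahBell r n :
  umbral (rLahBell_poly lambda r n) = deg_rising lambda%:P ('X + r%:R%:P) n.
Proof.
rewrite lambda_rLahP /rLahBell_poly linear_sum.
by apply: eq_bigr => k _; rewrite linearZ /= umbralXn.
Qed.

(** The left side does not involve [j]: the expansion holds for every [j], and is put in shifted
    form so that a factor [fall j] can be absorbed by [umbral_mulXn]. *)
Lemma deg_rising_shift r m n j :
  deg_rising lambda%:P ('X + r%:R%:P + m%:R * lambda%:P) n =
  \sum_(k < n.+1) ('C(n, k)%:R * (rising (m + j)%:R (n - k) * lambda ^+ (n - k)))
    *: (umbral (rLahBell_poly lambda r k) \Po ('X - (j%:R * lambda)%:P)).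
Proof.
have -> : 'X + r%:R%:P + m%:R * lambda%:P =
    ('X + r%:R%:P + (m + j)%:R * lambda%:P) \Po ('X - (j%:R * lambda)%:P).
  rewrite !comp_polyD comp_polyM -polyC_natr !comp_polyC comp_polyX.
  by rewrite !polyCM !polyC_natr natrD; ring.
(* Vandermonde with [x = 'X + r] and [y = (m + j) lambda]. *)
rewrite -comp_deg_rising deg_rising_Vandermonde linear_sum.
apply: eq_bigr => k _ /=; rewrite umbral_rLahBell -linearZ /=; congr (_ \Po _).
rewrite deg_rising_scale -mul_polyC !polyCM polyC_natr rmorphXn /=.
(* Vandermonde was used over [{poly R}]; its rising factorial is a constant polynomial. *)
suff -> : (rising (m + j)%:R (n - k))%:P = rising (m + j)%:R (n - k) :> {poly R}.
  by ring.
rewrite /rising rmorph_prod; apply: eq_bigr => i _ /=.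
by rewrite polyCD !polyC_natr.
Qed.

Lemma rLahBell_polyD r m n :
  rLahBell_poly lambda r (n + m) =
  \sum_(j < m.+1) \sum_(k < n.+1)
    ('C(n, k)%:R * lambda_rLah lambda r m j * rising (m + j)%:R (n - k)
     * lambda ^+ (n - k)) *: ('X^j * rLahBell_poly lambda r k).
Proof.
apply: umbral_inj.
(* [addnC] puts the [m] factors first, as they are the ones expanded in the [fall j]. *)
rewrite umbral_rLahBell addnC deg_risingD lambda_rLahP mulr_suml linear_sum.
apply: eq_bigr => j _; rewrite (deg_rising_shift r m n j) mulr_sumr linear_sum.
apply: eq_bigr => k _ /=.
rewrite linearZ /= umbral_mulXn -scalerAl -scalerAr scalerA.
by congr (_ *: _); ring.
Qed.

End Umbral.

Theorem theorem3p4 (R : realType) (lambda : R) (lambda_neq0 : lambda != 0)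
    (r m n : nat) :
  (forall t : R,
     (rLahBell_poly lambda r (n + m)).[t] =
     \sum_(j < m.+1) \sum_(k < n.+1)
       'C(n, k)%:R * lambda_rLah lambda r m j * rising (m + j)%:R (n - k)
       * t ^+ j * lambda ^+ (n - k) * (rLahBell_poly lambda r k).[t])
  /\
  rLahBell lambda r (n + m) =
  \sum_(j < m.+1) \sum_(k < n.+1)
    'C(n, k)%:R * lambda_rLah lambda r m j * rising (m + j)%:R (n - k)
    * lambda ^+ (n - k) * rLahBell lambda r k.
Proof.
have eval t : (rLahBell_poly lambda r (n + m)).[t] =
    \sum_(j < m.+1) \sum_(k < n.+1)
      'C(n, k)%:R * lambda_rLah lambda r m j * rising (m + j)%:R (n - k)
      * t ^+ j * lambda ^+ (n - k) * (rLahBell_poly lambda r k).[t].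
  rewrite rLahBell_polyD horner_sum; apply: eq_bigr => j _.
  rewrite horner_sum; apply: eq_bigr => k _.
  by rewrite hornerZ hornerM hornerXn; ring.
split=> //; rewrite /rLahBell eval.
by do 2!apply: eq_bigr => ? _; rewrite expr1n mulr1.
Qed.
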